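(* Let $1\le p\le 2$. Suppose that the matrix coefficients satisfy $$A_{j,j}=A_{j,j}^{*},\qquad A_{j+1,j}=A_{j,j+1}>0,\qquad j\ge 0.$$ If for some $z_0\in\mathbb{R}$ all solutions $u=(u_j)_{j\ge -1}$ of the equation $$A_{j,j-1}u_{j-1}+A_{j,j}u_j+A_{j,j+1}u_{j+1}=z\,u_j,\qquad j\ge 0,$$ with $z=z_0$ belong to $l_n^p$, then for any $z\in\mathbb{C}$ all solutions of this equation belong to $l_n^p$.
   Context: Fix $n\ge 1$. The coefficients $A_{i,j}$ ($i,j\ge 0$, $|i-j|\le 1$) are $n\times n$ complex matrices, with $A_{i+1,i}$, $A_{i,i+1}$ invertible for all $i\ge 0$; in addition $A_{0,-1}=-E$, where $E$ is the $n\times n$ unit matrix. The symbol $*$ denotes Hermitian conjugation, and $B>0$ means that $B$ is Hermitian positive definite. The unknowns $u_j\in\mathbb{C}^n$ ($j\ge-1$) are column vectors. For $1\le p<\infty$, $l_n^p$ is the Banach space of sequences $u=(u_{-1},u_0,u_1,\dots)$ with $u_j\in\mathbb{C}^n$ and $\|u\|_p=(\sum_j|u_j|^p)^{1/p}<\infty$, where $|\cdot|$ is a fixed vector norm on $\mathbb{C}^n$. *)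

(* Defs.v *)
From HB Require Import structures.
From mathcomp Require Import all_boot all_order all_algebra.
From mathcomp Require Import sesquilinear spectral.
From mathcomp Require Import all_classical all_reals all_analysis.
From mathcomp Require Export complex.
Set Implicit Arguments.
Unset Strict Implicit.
Unset Printing Implicit Defensive.
Import Order.TTheory GRing.Theory Num.Theory.
Local Open Scope ring_scope.
Local Open Scope complex_scope.
Local Open Scope sesquilinear_scope.

Definition posdefmx (R : realType) (n : nat) (B : 'M[R[i]]_n) : Prop :=
  B = B ^t* /\
  forall x : 'cV[R[i]]_n, x != 0 -> 0 < (x ^t* *m B *m x) 0 0.

Record vector_norm (R : realType) (n : nat) (N : 'cV[R[i]]_n -> R) : Prop :=
  VectorNorm {
    vnormD : forall x y : 'cV[R[i]]_n, N (x + y) <= N x + N y;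
    vnormZ : forall (a : R[i]) (x : 'cV[R[i]]_n), N (a *: x) = Normc.normc a * N x;
    vnorm_eq0 : forall x : 'cV[R[i]]_n, N x = 0 -> x = 0 }.

(* A sequence (u_j)_{j >= -1} is encoded with a shift: [u k] is u_{k-1}. *)
Definition in_lp (R : realType) (n : nat) (N : 'cV[R[i]]_n -> R) (p : R)
    (u : nat -> 'cV[R[i]]_n) : Prop :=
  finite_norm counting p%:E (N \o u).

(* [A i j] is A_{i,j} for i, j >= 0, only the entries with |i - j| <= 1 being
   used; [subcoef A j] is A_{j,j-1}, with A_{0,-1} = -E. *)
Definition subcoef (R : realType) (n : nat) (A : nat -> nat -> 'M[R[i]]_n)
    (j : nat) : 'M[R[i]]_n :=
  if j is j'.+1 then A j j' else - 1%:M.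

Definition is_solution (R : realType) (n : nat)
    (A : nat -> nat -> 'M[R[i]]_n) (z : R[i]) (u : nat -> 'cV[R[i]]_n) : Prop :=
  forall j : nat,
    subcoef A j *m u j + A j j *m u j.+1 + A j j.+1 *m u j.+2 = z *: u j.+1.

(* Main.v *)
Require Import Defs.
From HB Require Import structures.
From mathcomp Require Import all_boot all_order all_algebra.
From mathcomp Require Import sesquilinear spectral.
From mathcomp Require Import all_classical all_reals all_analysis.
Import Order.TTheory GRing.Theory Num.Theory.
Local Open Scope ring_scope.
Local Open Scope complex_scope.
Local Open Scope sesquilinear_scope.
Import numFieldNormedType.Exports.
Set Implicit Arguments.
Unset Strict Implicit.
Unset Printing Implicit Defensive.

(** The recurrence reads [S_j u_j + D_j u_(j+1) + S_(j+1) u_(j+2) = z u_(j+1)]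
with Hermitian [S_j], [D_j] and invertible [S_j].  Such a system has a conserved
quantity: for two solutions [X], [Y] at spectral parameters [a] and [b] the
Wronskian [W_j(X, Y) = X_j^* S_j Y_(j+1) - X_(j+1)^* S_j Y_j] satisfies
[W_(j+1) = W_j + (b - conj a) X_(j+1)^* Y_(j+1)] ([wronskianS]).

Let [X] be the [n x 2n] fundamental solution at the real point [z0].  Then
[W(X, X)] is a constant invertible matrix [J], so any sequence [u] can be
recovered from the vector [c_j = W_j(X, u)] by [u_j = X_j J^-1 c_j] and
[u_(j+1) = X_(j+1) J^-1 c_j] ([wronskian_recover]).  If [u] is a solution at
[z], the increment formula becomes a first order recurrence
[c_(j+1) = c_j + (z - z0) X_(j+1)^* X_(j+1) J^-1 c_j], whence
[|c_(j+1)| <= (1 + L |X_(j+1)|^2) |c_j|].  The columns of [X] are in [l^p] by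
hypothesis, hence in [l^2] because [p <= 2], so the product of these factors
converges, [c] is bounded, and [|u_j| <= K |X_j|] gives [u] in [l^p]
([jacobi_psummable]).  This is the method of variation of constants.

The estimates use the sum [mnorm] of the moduli of all entries, which is
submultiplicative and invariant under adjunction for matrices of every shape.
Comparing it with the given vector norm is the equivalence of norms in finite
dimension, which rests on the compactness of a real unit sphere
([mnorm_le_vnorm]). *)

(** * The entrywise norm of a complex matrix *)

Definition mnorm (R : realType) (m n : nat) (M : 'M[R[i]]_(m, n)) : R :=
  \sum_i \sum_j Normc.normc (M i j).

Lemma normc_ge0 (R : realType) (x : R[i]) : 0 <= Normc.normc x.
Proof. by case: x => a b; exact: sqrtr_ge0. Qed.

Lemma normcD (R : realType) (x y : R[i]) :
  Normc.normc (x + y) <= Normc.normc x + Normc.normc y.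
Proof. exact: le_normcD. Qed.

Lemma normc_sum (R : realType) (I : finType) (F : I -> R[i]) :
  Normc.normc (\sum_i F i) <= \sum_i Normc.normc (F i).
Proof.
elim/big_ind2: _ => [|x1 y1 x2 y2 h1 h2|//]; first by rewrite Normc.normc0.
by apply: le_trans (normcD _ _) _; apply: lerD.
Qed.

Lemma normcJ (R : realType) (x : R[i]) : Normc.normc (Num.conj x) = Normc.normc x.
Proof. by case: x => a b /=; rewrite sqrrN. Qed.

Lemma mnorm_ge0 (R : realType) (m n : nat) (M : 'M[R[i]]_(m, n)) : 0 <= mnorm M.
Proof. by apply: sumr_ge0 => i _; apply: sumr_ge0 => j _; exact: normc_ge0. Qed.

Lemma mnormD (R : realType) (m n : nat) (M M' : 'M[R[i]]_(m, n)) :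
  mnorm (M + M') <= mnorm M + mnorm M'.
Proof.
rewrite -big_split ler_sum// => i _; rewrite -big_split ler_sum// => j _.
by rewrite mxE; exact: normcD.
Qed.

Lemma mnormZ (R : realType) (m n : nat) (a : R[i]) (M : 'M[R[i]]_(m, n)) :
  mnorm (a *: M) = Normc.normc a * mnorm M.
Proof.
rewrite /mnorm mulr_sumr; apply: eq_bigr => i _; rewrite mulr_sumr.
by apply: eq_bigr => j _; rewrite mxE Normc.normcM.
Qed.

Lemma mnormM (R : realType) (m n q : nat) (M : 'M[R[i]]_(m, n)) (M' : 'M[R[i]]_(n, q)) :
  mnorm (M *m M') <= mnorm M * mnorm M'.
Proof.
rewrite /mnorm mulr_suml ler_sum// => i _; rewrite mulr_suml.
apply: (@le_trans _ _ (\sum_k \sum_j Normc.normc (M i j) * Normc.normc (M' j k))).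
  apply: ler_sum => k _; rewrite mxE; apply: le_trans (normc_sum _) _.
  by apply: ler_sum => j _; rewrite Normc.normcM.
rewrite exchange_big ler_sum// => j _; rewrite -mulr_sumr ler_wpM2l ?normc_ge0//.
rewrite [leRHS](bigD1 j)//= lerDl; apply: sumr_ge0 => l _.
by apply: sumr_ge0 => k _; exact: normc_ge0.
Qed.

Lemma mnorm_adj (R : realType) (m n : nat) (M : 'M[R[i]]_(m, n)) :
  mnorm (M ^t*) = mnorm M.
Proof.
rewrite /mnorm exchange_big; apply: eq_bigr => i _; apply: eq_bigr => j _.
by rewrite !mxE normcJ.
Qed.

Lemma mnorm_col (R : realType) (m n : nat) (M : 'M[R[i]]_(m, n)) :
  mnorm M = \sum_j mnorm (col j M).
Proof.
rewrite /mnorm exchange_big; apply: eq_bigr => j _; apply: eq_bigr => i _.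
by rewrite big_ord1 mxE.
Qed.

(** * Equivalence of norms *)

Lemma vnorm0 (R : realType) (n : nat) (N : 'cV[R[i]]_n -> R) :
  vector_norm N -> N 0 = 0.
Proof. by move=> hN; rewrite -(scale0r 0) (vnormZ hN) Normc.normc0 mul0r. Qed.

Lemma vnormN (R : realType) (n : nat) (N : 'cV[R[i]]_n -> R) :
  vector_norm N -> forall x, N (- x) = N x.
Proof.
move=> hN x; rewrite -scaleN1r (vnormZ hN) normcN Normc.normc1 mul1r//.
Qed.

Lemma vnorm_ge0 (R : realType) (n : nat) (N : 'cV[R[i]]_n -> R) :
  vector_norm N -> forall x, 0 <= N x.
Proof.
move=> hN x; have := vnormD hN x (- x); rewrite subrr vnorm0// vnormN//.
by rewrite -mulr2n pmulrn_lge0.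
Qed.

Lemma vnorm_le_mnorm (R : realType) (n : nat) (N : 'cV[R[i]]_n -> R) :
  vector_norm N -> exists2 K, 0 <= K & forall x, N x <= K * mnorm x.
Proof.
move=> hN; exists (\sum_i N (delta_mx i 0)).
  by apply: sumr_ge0 => i _; exact: vnorm_ge0.
move=> x; rewrite {1}(matrix_sum_delta x) mulr_suml.
apply: (@le_trans _ _ (\sum_i N (x i 0 *: delta_mx i 0))).
  elim/big_ind2: _ => [|y a y' a' h1 h2|i _]; first by rewrite vnorm0.
    by apply: le_trans (vnormD hN _ _) _; exact: lerD.
  by rewrite big_ord1.
apply: ler_sum => i _; rewrite (vnormZ hN) mulrC ler_wpM2l ?vnorm_ge0//.
rewrite /mnorm (bigD1 i)//= big_ord1 lerDl; apply: sumr_ge0 => k _.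
by rewrite big_ord1 normc_ge0.
Qed.

(** The identification of [C^n] with [R^(2n)], real parts first, through which
compactness in real row spaces applies. *)
Definition ccol (R : realType) (n : nat) (r : 'rV[R]_(n + n)) : 'cV[R[i]]_n :=
  \col_k (r 0 (lshift n k) +i* r 0 (rshift n k))%C.

Lemma normc_le_abs (R : realType) (a b : R) : Normc.normc (a +i* b)%C <= `|a| + `|b|.
Proof.
rewrite /= -[leRHS]ger0_norm ?addr_ge0// -sqrtr_sqr ler_wsqrtr//.
by rewrite sqrrD !real_normK ?num_real// lerD2r lerDl mulrn_wge0 ?mulr_ge0.
Qed.

Lemma mnorm_ccol (R : realType) (n : nat) (r : 'rV[R]_(n + n)) :
  mnorm (ccol r) <= (n + n)%:R * `|r|.
Proof.
have h (k : 'I_(n + n)) : `|r 0 k| <= `|r|.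
  have := @mx_normrE R 1 (n + n) r; rewrite /Num.norm/= => ->.
  exact: (le_bigmax _ (fun ij => `|r ij.1 ij.2|) (0, k)).
apply: (@le_trans _ _ (\sum_(k < n) (`|r| + `|r|))).
  apply: ler_sum => k _; rewrite big_ord1 mxE; apply: le_trans (normc_le_abs _ _) _.
  exact: lerD.
by rewrite big_const_ord iter_addr_0 natrD mulrDl !mulr_natl mulrnDl.
Qed.

Lemma ccolB (R : realType) (n : nat) (r s : 'rV[R]_(n + n)) :
  ccol (r - s) = ccol r - ccol s.
Proof. by apply/matrixP => i j; rewrite !mxE. Qed.

Lemma ccolZ (R : realType) (n : nat) (a : R) (r : 'rV[R]_(n + n)) :
  ccol (a *: r) = a%:C *: ccol r.
Proof. by apply/matrixP => i j; rewrite !mxE /GRing.mul /= !mul0r subr0 addr0. Qed.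

Lemma ccol_eq0 (R : realType) (n : nat) (r : 'rV[R]_(n + n)) : ccol r = 0 -> r = 0.
Proof.
move=> /matrixP h; apply/rowP => k; rewrite mxE.
case: (split_ordP k) => j ->; have := h j 0; rewrite !mxE => /eqP;
  by rewrite eq_complex /= => /andP[/eqP h1 /eqP h2].
Qed.

Lemma ccol_surj (R : realType) (n : nat) (x : 'cV[R[i]]_n) : exists r, x = ccol r.
Proof.
exists (row_mx (\row_k complex.Re (x k 0)) (\row_k complex.Im (x k 0))).
apply/colP => k; rewrite !mxE (unsplitK (inl k)) (unsplitK (inr k)) !mxE.
by case: (x k 0).
Qed.

(** A norm is Lipschitz for [mnorm], hence for the norm of [R^(2n)]. *)
Lemma vnorm_ccol_continuous (R : realType) (n : nat) (N : 'cV[R[i]]_n -> R) :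
  vector_norm N -> continuous (fun r : 'rV[R]_(n + n) => N (ccol r)).
Proof.
move=> hN; have [K K0 hK] := vnorm_le_mnorm hN.
have hL r : N (ccol r) <= (K * (n + n)%:R) * `|r|.
  by apply: le_trans (hK _) _; rewrite -mulrA ler_wpM2l// mnorm_ccol.
set L := K * _ in hL; have L0 : 0 <= L by rewrite mulr_ge0.
have hlip r s : `|N (ccol r) - N (ccol s)| <= L * `|r - s|.
  have h (a b : 'rV[R]_(n + n)) : N (ccol a) - N (ccol b) <= L * `|a - b|.
    rewrite lerBlDr; apply: le_trans (lerD (hL _) (lexx _)).
    by rewrite ccolB; apply: le_trans (vnormD hN _ _); rewrite subrK.
  by rewrite ler_norml h andbT lerNl opprB distrC h.
move=> r.
apply: (proj2 (@cvgrPdist_lt _ _ _ (nbhs r) (nbhs_filter r)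
  (fun s => N (ccol s)) (N (ccol r)))).
(* The radius has [L + 1] in the denominator because [L] may vanish. *)
move=> e e0; have d0 : 0 < e / (L + 1) by rewrite divr_gt0// ltr_wpDl.
apply: filterS (nbhsx_ballx r _ d0) => s; rewrite -ball_normE /= => rs.
apply: le_lt_trans (hlip _ _) _.
apply: (@le_lt_trans _ _ ((L + 1) * `|r - s|)).
  by rewrite ler_wpM2r// lerDl.
by rewrite mulrC -ltr_pdivlMr ?ltr_wpDl//.
Qed.

(** On the real unit sphere, which is compact, the continuous function [N] has a
minimum, positive since [N] vanishes only at 0; homogeneity extends the bound
to all vectors. *)
Lemma mnorm_le_vnorm (R : realType) (n : nat) (N : 'cV[R[i]]_n -> R) :
  vector_norm N -> exists2 C, 0 <= C & forall x, mnorm x <= C * N x.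
Proof.
move=> hN.
case: (posnP n) => [n0|n0].
  exists 0 => // x; rewrite /mnorm mul0r big1// => k _.
  by have := ltn_ord k; rewrite [X in (_ < X)%N]n0.
pose S := [set r : 'rV[R]_(n + n) | `|r| = 1]%classic.
have nS r : r != 0 -> S (`|r|^-1 *: r).
  by move=> r0; rewrite /S /= normrZ normfV normr_id mulVf// normr_eq0.
have S0 : (S !=set0)%classic.
  have i0 : 'I_(n + n) by apply: (@Ordinal _ 0); rewrite addn_gt0 n0.
  exists (`|delta_mx 0 i0 : 'rV[R]_(n + n)|^-1 *: delta_mx 0 i0); apply: nS.
  by apply/eqP => /matrixP /(_ 0 i0); rewrite !mxE !eqxx => /eqP; rewrite oner_eq0.
have cS : compact S.
  apply: bounded_closed_compact.
    exists 1; split=> // M M1 r /= ->; exact: ltW.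
  apply: (@preimage_closed _ _ (@Num.norm _ 'rV[R]_(n + n)) [set 1]%classic).
    by move=> ? _; exact: norm_continuous.
  exact: closed_eq.
have [|r0 r0S hmin] := EVT_min_rV S0 cS (f := fun r => N (ccol r)).
  apply: continuous_subspaceT; exact: vnorm_ccol_continuous.
set m := N (ccol r0) in hmin.
have m0 : 0 < m.
  rewrite lt_def vnorm_ge0// andbT; apply/eqP => /(vnorm_eq0 hN) /ccol_eq0 h.
  move: r0S; rewrite inE /S /= h normr0 => /eqP; by rewrite eq_sym oner_eq0.
exists ((n + n)%:R / m); first by rewrite divr_ge0// ltW.
move=> x; have [r ->] := ccol_surj x.
have [->|rn0] := eqVneq r 0.
  have -> : ccol (0 : 'rV[R]_(n + n)) = 0 by apply/matrixP => i j; rewrite !mxE.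
  rewrite (vnorm0 hN) mulr0 /mnorm big1// => i _; rewrite big1// => j _.
  by rewrite mxE Normc.normc0.
apply: le_trans (mnorm_ccol _) _; rewrite -mulrA ler_wpM2l// mulrC ler_pdivlMr//.
have := hmin (`|r|^-1 *: r); rewrite inE => /(_ (nS _ rn0)).
rewrite ccolZ (vnormZ hN) /= expr0n addr0 sqrtr_sqr normfV normr_id.
by rewrite mulrC ler_pdivlMr ?normr_gt0// mulrC.
Qed.

(** * Sequences with summable p-th powers *)

(** Bounded partial sums instead of an extended-real norm: the comparison
arguments then take place in [R]. *)
Definition psummable (R : realType) (p : R) (f : nat -> R) : Prop :=
  exists M, forall m, \sum_(k < m) f k `^ p <= M.

Lemma finite_norm_psummable (R : realType) (p : R) (f : nat -> R) :
  0 < p -> (forall k, 0 <= f k) ->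
  finite_norm (@counting nat R) p%:E f <-> psummable p f.
Proof.
move=> p0 f0; rewrite /finite_norm Lnorm_counting//=.
have E m : (\sum_(0 <= k < m) `|(f k)%:E| `^ p)%E = (\sum_(k < m) f k `^ p)%:E.
  rewrite big_mkord -sumEFin; apply: eq_bigr => k _.
  by rewrite abse_EFin ger0_norm// poweR_EFin.
have ge0 k : (0 <= k)%N -> true -> (0 <= `|(f k)%:E| `^ p :> \bar R)%E.
  by move=> _ _; exact: poweR_ge0.
split=> [/lty_poweRy h|[M hM]].
  have {}h := h _; set s := (X in (X < _)%E) in h.
  have sfin : s \is a fin_num by rewrite ge0_fin_numE ?h ?invr_neq0 ?gt_eqF// nneseries_ge0.
  exists (fine s) => m; rewrite -lee_fin fineK// -E.
  exact: nneseries_lim_ge.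
apply: poweR_lty; apply: le_lt_trans (ltry M).
apply: lime_le; first exact: is_cvg_nneseries.
by near=> m; rewrite E lee_fin.
Unshelve. all: by end_near.
Qed.

Lemma psummable_le (R : realType) (p K : R) (f g : nat -> R) :
  0 <= p -> 0 <= K -> (forall k, 0 <= f k) -> (forall k, 0 <= g k) ->
  (forall k, f k <= K * g k) -> psummable p g -> psummable p f.
Proof.
move=> p0 K0 f0 g0 fg [M hM]; exists (K `^ p * M) => m.
apply: le_trans (ler_wpM2l (powR_ge0 _ _) (hM m)); rewrite mulr_sumr.
by apply: ler_sum => k _; rewrite -powRM// ge0_ler_powR ?nnegrE ?mulr_ge0.
Qed.

(** The larger of [a], [b] carries the sum: [(a + b)^p <= (2 max(a, b))^p]. *)
Lemma psummableD (R : realType) (p : R) (f g : nat -> R) :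
  0 <= p -> (forall k, 0 <= f k) -> (forall k, 0 <= g k) ->
  psummable p f -> psummable p g -> psummable p (fun k => f k + g k).
Proof.
move=> p0 f0 g0 [M hM] [M' hM']; exists (2 `^ p * (M + M')) => m.
apply: le_trans (ler_wpM2l (powR_ge0 _ _) (lerD (hM m) (hM' m))).
rewrite -big_split mulr_sumr; apply: ler_sum => k _ /=.
have h (a b : R) : 0 <= a -> a <= b -> (a + b) `^ p <= 2 `^ p * (a `^ p + b `^ p).
  move=> a0 ab; have b0 := le_trans a0 ab.
  apply: (@le_trans _ _ ((2 * b) `^ p)).
    by rewrite ge0_ler_powR// ?nnegrE ?mulr_ge0 ?addr_ge0// mulr_natl mulr2n lerD2r.
  by rewrite powRM// ler_wpM2l ?powR_ge0// lerDr powR_ge0.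
have [ab|/ltW ab] := leP (f k) (g k); first exact: h.
by rewrite (addrC (f k)) (addrC (f k `^ p)); exact: h.
Qed.

Lemma psummable_sum (R : realType) (p : R) (I : finType) (F : I -> nat -> R) :
  0 < p -> (forall i k, 0 <= F i k) ->
  (forall i, psummable p (F i)) -> psummable p (fun k => \sum_i F i k).
Proof.
move=> p0 F0 hF; elim: (index_enum I) => [|i s IH].
  exists 0 => m; rewrite big1// => k _; rewrite big_nil powR0// gt_eqF//.
have [M hM] := psummableD (ltW p0) (F0 i) (fun k => sumr_ge0 _ (fun j _ => F0 j k)) (hF i) IH.
by exists M => m; under eq_bigr do rewrite big_cons; exact: hM.
Qed.

(** The terms of a p-summable sequence are bounded, by [1 + M] here, and
[x^2 = x^(2 - p) x^p] with [2 - p >= 0]. *)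
Lemma psummable_sqr (R : realType) (p : R) (f : nat -> R) :
  1 <= p <= 2 -> (forall k, 0 <= f k) -> psummable p f ->
  exists M, forall m, \sum_(k < m) f k ^+ 2 <= M.
Proof.
move=> /andP[p1 p2] f0 [M hM].
have p0 : 0 <= p := le_trans ler01 p1.
have fM k : f k <= 1 + M.
  have fpM : f k `^ p <= M.
    apply: le_trans (hM k.+1); rewrite big_ord_recr lerDr.
    by apply: sumr_ge0 => l _; exact: powR_ge0.
  have [f1|/ltW f1] := leP (f k) 1.
    by apply: le_trans f1 _; rewrite lerDl; exact: le_trans (powR_ge0 _ _) fpM.
  apply: (@le_trans _ _ (f k `^ p)); last by apply: le_trans fpM _; rewrite lerDr.
  by rewrite -[leLHS](powRr1 (f0 k)) ler_powR.
exists ((1 + M) `^ (2 - p) * M) => m.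
apply: le_trans (ler_wpM2l (powR_ge0 _ _) (hM m)).
rewrite mulr_sumr; apply: ler_sum => k _.
rewrite -(powR_mulrn 2 (f0 k)).
have -> : 2%:R = (2 - p) + p by rewrite subrK.
rewrite powRD ?subrK ?pnatr_eq0// ler_wpM2r ?powR_ge0// ge0_ler_powR//
  ?subr_ge0 ?nnegrE//; exact: le_trans (f0 k) (fM k).
Qed.

(** Norm equivalence makes the space independent of the chosen norm. *)
Lemma in_lpE (R : realType) (n : nat) (N : 'cV[R[i]]_n -> R) (p : R)
    (u : nat -> 'cV[R[i]]_n) : 0 < p -> vector_norm N ->
  in_lp N p u <-> psummable p (fun k => mnorm (u k)).
Proof.
move=> p0 hN; have [K K0 hK] := vnorm_le_mnorm hN.
have [C C0 hC] := mnorm_le_vnorm hN.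
rewrite /in_lp finite_norm_psummable//=; last by move=> k; exact: vnorm_ge0.
have N0 k : 0 <= N (u k) by exact: vnorm_ge0.
have m0 k : 0 <= mnorm (u k) by exact: mnorm_ge0.
by split; [apply: (@psummable_le _ _ C _ _ (ltW p0)) => // k; exact: hC
  | apply: (@psummable_le _ _ K _ _ (ltW p0)) => // k; exact: hK].
Qed.

(** * The Wronskian of a Hermitian three-term recurrence *)

Lemma adjM (R : realType) (m n q : nat) (X : 'M[R[i]]_(m, n)) (Y : 'M[R[i]]_(n, q)) :
  (X *m Y) ^t* = Y ^t* *m X ^t*.
Proof. by rewrite trmx_mul map_mxM. Qed.

Lemma adjD (R : realType) (m n : nat) (X Y : 'M[R[i]]_(m, n)) :
  (X + Y) ^t* = X ^t* + Y ^t*.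
Proof. by rewrite linearD map_mxD. Qed.

Lemma adjZ (R : realType) (m n : nat) (a : R[i]) (X : 'M[R[i]]_(m, n)) :
  (a *: X) ^t* = Num.conj a *: X ^t*.
Proof. by rewrite linearZ map_mxZ. Qed.

Definition wronskian (R : realType) (n q r : nat) (S : nat -> 'M[R[i]]_n)
    (X : nat -> 'M[R[i]]_(n, q)) (Y : nat -> 'M[R[i]]_(n, r)) (j : nat) :=
  (X j) ^t* *m S j *m Y j.+1 - (X j.+1) ^t* *m S j *m Y j.

(** Discrete Green identity: pairing each recurrence with the other solution
cancels the [D] terms. *)
Lemma wronskianS (R : realType) (n q r : nat) (S D : nat -> 'M[R[i]]_n)
    (X : nat -> 'M[R[i]]_(n, q)) (Y : nat -> 'M[R[i]]_(n, r)) (a b : R[i]) (j : nat) :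
  (forall k, S k = (S k) ^t*) -> D j = (D j) ^t* ->
  S j *m X j + D j *m X j.+1 + S j.+1 *m X j.+2 = a *: X j.+1 ->
  S j *m Y j + D j *m Y j.+1 + S j.+1 *m Y j.+2 = b *: Y j.+1 ->
  wronskian S X Y j.+1 =
    wronskian S X Y j + (b - Num.conj a) *: ((X j.+1) ^t* *m Y j.+1).
Proof.
move=> hS hD eX eY.
have /(congr1 (fun M => M ^t* *m Y j.+1)) := eX.
have /(congr1 (fun M => (X j.+1) ^t* *m M)) := eY.
rewrite adjZ -scalemxAl -scalemxAr !adjD !adjM -!hS -hD.
rewrite !mulmxDl !mulmxDr !mulmxA scalerBl => <- <-.
rewrite /wronskian.
set a1 := _ *m Y j.+2; set a2 := _ *m Y j.+1; set a3 := _ *m Y j.+1.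
set a4 := _ *m Y j; set a5 := _ *m Y j.+1.
rewrite !opprD !addrA.
by rewrite subrK -[a3 + a5 + a1]addrA [a3 + _]addrC addrK [a5 + a1]addrC addrK.
Qed.

(** The hypothesis says that [J^-1 B] is a left inverse of the square matrix
with blocks [X], [X'], where [B = (- X'^* S, X^* S)]; a left inverse of a square
matrix is also a right inverse, and the conclusion reads
[col_mx X X' *m (J^-1 B) = 1]. *)
Lemma wronskian_recover (R : realType) (n : nat) (S : 'M[R[i]]_n)
    (X X' : 'M[R[i]]_(n, n + n)) (J : 'M[R[i]]_(n + n)) (y y' : 'cV[R[i]]_n) :
  X ^t* *m S *m X' - X' ^t* *m S *m X = J -> J \in unitmx ->
  y = X *m (invmx J *m (X ^t* *m S *m y' - X' ^t* *m S *m y)) /\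
  y' = X' *m (invmx J *m (X ^t* *m S *m y' - X' ^t* *m S *m y)).
Proof.
move=> hJ uJ; pose B := row_mx (- (X' ^t* *m S)) (X ^t* *m S).
have hB q (x x' : 'M[R[i]]_(n, q)) :
    B *m col_mx x x' = X ^t* *m S *m x' - X' ^t* *m S *m x.
  by rewrite mul_row_col mulNmx addrC.
have h1 : (invmx J *m B) *m col_mx X X' = 1%:M by rewrite -mulmxA hB hJ mulVmx.
have h2 := mulmx1C h1; have := congr1 (fun M => M *m col_mx y y') h2.
rewrite mul1mx -[LHS]mulmxA -[X in _ *m X = _]mulmxA hB mul_col_mx => /eq_col_mx[-> ->].
by [].
Qed.

(** The pair [(X_j, X_(j+1))] of the solution with initial block
[col_mx X_0 X_1 = 1], so that the columns of [X] form a basis of solutions. *)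
Fixpoint fundpair (R : realType) (n : nat) (S D : nat -> 'M[R[i]]_n) (a : R[i]) (j : nat)
   : 'M[R[i]]_(n, n + n) * 'M[R[i]]_(n, n + n) :=
  if j is k.+1 then
    let X := fundpair S D a k in
    (X.2, invmx (S k.+1) *m (a *: X.2 - S k *m X.1 - D k *m X.2))
  else (row_mx 1%:M 0, row_mx 0 1%:M).

Definition fundsol (R : realType) (n : nat) (S D : nat -> 'M[R[i]]_n) (a : R[i]) (j : nat) :=
  (fundpair S D a j).1.

Lemma fundsolP (R : realType) (n : nat) (S D : nat -> 'M[R[i]]_n) (a : R[i]) (j : nat) :
  S j.+1 \in unitmx -> let X := fundsol S D a in
  S j *m X j + D j *m X j.+1 + S j.+1 *m X j.+2 = a *: X j.+1.
Proof.
move=> uS X; rewrite /X /fundsol /= mulKVmx// -[_ - _ - _]addrA -opprD [LHS]addrC.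
by rewrite subrK.
Qed.

(** Iteration bounds [f j] by the product of the factors [1 + b k], each of which
is at most [exp (b k)]. *)
Lemma growth_bounded (R : realType) (f b : nat -> R) (M : R) :
  (forall j, 0 <= f j) -> (forall j, f j.+1 <= (1 + b j) * f j) ->
  (forall m, \sum_(k < m) b k <= M) -> (forall j, 0 <= b j) ->
  forall j, f j <= expR M * f 0.
Proof.
move=> f0 hf hM b0 j; apply: (@le_trans _ _ (expR (\sum_(k < j) b k) * f 0)).
  elim: j => [|j IH]; first by rewrite big_ord0 expR0 mul1r.
  apply: le_trans (hf j) _; rewrite big_ord_recr /= addrC expRD -mulrA.
  apply: ler_pM => //; first by rewrite addr_ge0.
  exact: expR_ge1Dx.
by rewrite ler_wpM2r// ler_expR.
Qed.

(** * Changing the spectral parameter *)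

Definition jacobi_eq (R : realType) (n q : nat) (S D : nat -> 'M[R[i]]_n) (z : R[i])
    (X : nat -> 'M[R[i]]_(n, q)) : Prop :=
  forall j, S j *m X j + D j *m X j.+1 + S j.+1 *m X j.+2 = z *: X j.+1.

Lemma jacobi_eq_col (R : realType) (n q : nat) (S D : nat -> 'M[R[i]]_n) (z : R[i])
    (X : nat -> 'M[R[i]]_(n, q)) (d : 'I_q) :
  jacobi_eq S D z X -> jacobi_eq S D z (fun j => col d (X j)).
Proof.
by move=> hX j; rewrite !colE !mulmxA -!mulmxDl hX scalemxAl.
Qed.

Lemma conj_real (R : realType) (a : R) : Num.conj a%:C = a%:C.
Proof. by rewrite /Num.conj /= /conjc oppr0. Qed.

(** Since [a] is real the Wronskian is constant; its initial value is the
symplectic block matrix of [S_0]. *)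
Lemma wronskian_fundsol (R : realType) (n : nat) (S D : nat -> 'M[R[i]]_n) (a : R) :
  (forall k, S k = (S k) ^t*) -> (forall k, D k = (D k) ^t*) ->
  (forall k, S k \in unitmx) ->
  let X := fundsol S D a%:C in
  exists2 J, J \in unitmx & forall j, wronskian S X X j = J.
Proof.
move=> hS hD uS X; exists (wronskian S X X 0); last first.
  elim=> [//|j <-].
  have eX := fundsolP D a%:C (uS j.+1).
  rewrite (wronskianS hS (hD j) eX eX).
  by rewrite conj_real subrr scale0r addr0.
have -> : wronskian S X X 0 = block_mx 0 (S 0) (- S 0) 0.
  rewrite /wronskian /X /fundsol /= !tr_row_mx !map_col_mx !trmx1 !trmx0 !map_mx1 !map_mx0.
  rewrite ![col_mx _ _ *m S 0]mul_col_mx !mul1mx !mul0mx !mul_col_row !mul0mx !mulmx0 !mulmx1.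
  by rewrite opp_block_mx add_block_mx !subr0 sub0r.
apply: (proj1 (@mulmx1_unit _ _ _ (block_mx 0 (- invmx (S 0)) (invmx (S 0)) 0) _)).
rewrite mulmx_block !mul0mx !mulmx0 !mulNmx !mulmxN opprK mulmxV// !addr0 !add0r.
by rewrite -scalar_mx_block.
Qed.

(** The coordinates [c_j = W_j(X, u)] of [u] along the fundamental solution
stay bounded, so [u] inherits the summability of [X]. *)
Lemma jacobi_psummable (R : realType) (n : nat) (S D : nat -> 'M[R[i]]_n) (p a : R) :
  (forall k, S k = (S k) ^t*) -> (forall k, D k = (D k) ^t*) ->
  (forall k, S k \in unitmx) ->
  1 <= p <= 2 ->
  (forall u : nat -> 'cV[R[i]]_n,
     jacobi_eq S D a%:C u -> psummable p (fun j => mnorm (u j))) ->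
  forall z (u : nat -> 'cV[R[i]]_n),
    jacobi_eq S D z u -> psummable p (fun j => mnorm (u j)).
Proof.
move=> hS hD uS hp ha z u hu; have p1 : 1 <= p by case/andP: hp.
have p0 : 0 < p := lt_le_trans ltr01 p1.
pose X := fundsol S D a%:C.
have eX : jacobi_eq S D a%:C X by move=> j; exact: fundsolP.
have [J uJ hJ] := @wronskian_fundsol _ _ S D a hS hD uS.
have X0 k : 0 <= mnorm (X k) := mnorm_ge0 _.
have sX : psummable p (fun j => mnorm (X j)).
  have [M hM] : psummable p (fun j => \sum_d mnorm (col d (X j))).
    apply: psummable_sum => // [d k|d]; first exact: mnorm_ge0.
    by apply: ha; exact: jacobi_eq_col.
  by exists M => m; under eq_bigr do rewrite mnorm_col; exact: hM.
have [M hM] := psummable_sqr hp X0 sX.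
pose c := wronskian S X u.
have hrec j := wronskian_recover (u j) (u j.+1) (hJ j) uJ.
pose L := Normc.normc (z - a%:C) * mnorm (invmx J).
have L0 : 0 <= L by rewrite mulr_ge0 ?normc_ge0 ?mnorm_ge0.
have hc j : mnorm (c j.+1) <= (1 + L * mnorm (X j.+1) ^+ 2) * mnorm (c j).
  rewrite /c (wronskianS hS (hD j) (eX j) (hu j)) -/c.
  rewrite conj_real; apply: le_trans (mnormD _ _) _.
  rewrite mulrDl mul1r lerD2l mnormZ /L -!mulrA.
  rewrite ler_wpM2l ?normc_ge0//.
  apply: le_trans (mnormM _ _) _; rewrite mnorm_adj.
  rewrite {1}(proj2 (hrec j)) -/(wronskian S X u j) -/c.
  apply: le_trans (ler_wpM2l (mnorm_ge0 _) (mnormM _ _)) _.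
  rewrite -/X [leRHS]mulrCA ler_wpM2l// [leRHS]mulrCA ler_wpM2l//.
  exact: mnormM.
have hcb := @growth_bounded _ (fun j => mnorm (c j))
  (fun j => L * mnorm (X j.+1) ^+ 2) (L * M).
apply: (@psummable_le _ _ (mnorm (invmx J) * (expR (L * M) * mnorm (c 0)))
  _ _ (ltW p0) _ _ X0 _ sX).
- by rewrite !mulr_ge0 ?expR_ge0 ?mnorm_ge0.
- by move=> k; exact: mnorm_ge0.
move=> j; rewrite {1}(proj1 (hrec j)) -/(wronskian S X u j) -/c mulrC.
apply: le_trans (mnormM _ _) _; rewrite ler_wpM2l ?mnorm_ge0//.
apply: le_trans (mnormM _ _) _; rewrite ler_wpM2l ?mnorm_ge0//.
apply: hcb => // [k|m|k]; first exact: mnorm_ge0.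
  rewrite -mulr_sumr ler_wpM2l//; apply: le_trans (hM m.+1).
  by rewrite big_ord_recl lerDr sqr_ge0.
by rewrite mulr_ge0// sqr_ge0.
Qed.

Theorem theorem3 (R : realType) (n : nat) (hn : (1 <= n)%N)
    (A : nat -> nat -> 'M[R[i]]_n)
    (hinv : forall i : nat, A i.+1 i \in unitmx /\ A i i.+1 \in unitmx)
    (N : 'cV[R[i]]_n -> R) (hN : vector_norm N)
    (p : R) (hp : 1 <= p <= 2)
    (hdiag : forall j : nat, A j j = (A j j) ^t*)
    (hoff : forall j : nat, A j.+1 j = A j j.+1 /\ posdefmx (A j j.+1))
    (hz0 : exists z0 : R, forall u : nat -> 'cV[R[i]]_n,
       is_solution A z0%:C u -> in_lp N p u) :
  forall (z : R[i]) (u : nat -> 'cV[R[i]]_n), is_solution A z u -> in_lp N p u.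
Proof.
case: hz0 => a ha z u hu.
have p0 : 0 < p by case/andP: hp => p1 _; exact: lt_le_trans p1.
(* Both off-diagonal coefficients come from the single Hermitian family
   [subcoef A]: row [j] has [subcoef A j] below and [subcoef A j.+1] above the
   diagonal.  This includes [j = 0], where [subcoef A 0 = - 1]. *)
have solE w v : is_solution A w v <-> jacobi_eq (subcoef A) (fun j => A j j) w v.
  by split=> h j; move: (h j); rewrite /= (proj1 (hoff j)).
apply/(in_lpE _ p0 hN).
apply: (@jacobi_psummable _ _ (subcoef A) (fun j => A j j) p a _ _ _ hp _ z).
- case=> [|k] /=; first by rewrite linearN /= trmx1 map_mxN map_mx1.
  by have [-> [<- _]] := hoff k.
- exact: hdiag.
- case=> [|k] /=; first by rewrite -scaleN1r unitmxZ ?unitmx1// unitrN1.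
  by have [] := hinv k.
- by move=> v /solE /ha /(in_lpE _ p0 hN).
- exact/solE.
Qed.
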